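(* Let $k\geq 1$ be an integer with $k\neq 2$. Then all positive integer solutions $(x,y)$ of the equation $x^{2}-(k^{2}+1)y^{2}=-4$ are given by $$(x,y)=\left(V_{2n-1}(2k,1),2U_{2n-1}(2k,1)\right)$$ with $n\geq 1$. That is, the set of pairs of positive integers solving the equation is exactly the set of these pairs as $n$ ranges over the integers $n\ge 1$.
   Context: For nonzero integers $m,s$ with $m^{2}+4s>0$, the generalized Fibonacci sequence is defined by $U_{0}(m,s)=0$, $U_{1}(m,s)=1$, $U_{n+1}(m,s)=mU_{n}(m,s)+sU_{n-1}(m,s)$ for $n\ge 1$, and the generalized Lucas sequence by $V_{0}(m,s)=2$, $V_{1}(m,s)=m$, $V_{n+1}(m,s)=mV_{n}(m,s)+sV_{n-1}(m,s)$ for $n\ge 1$. *)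

(* Defs.v *)
From mathcomp Require Import all_boot all_order all_algebra.

Set Implicit Arguments.
Unset Strict Implicit.
Unset Printing Implicit Defensive.

Local Open Scope ring_scope.

(* Both sequences are defined for all integers m and s, although the usual
   conventions ask for m, s nonzero and m ^ 2 + 4 s > 0. *)
Fixpoint gen_fib (m s : int) (n : nat) : int :=
  match n with
  | 0%N => 0
  | n1.+1 =>
      match n1 with
      | 0%N => 1
      | n2.+1 => m * gen_fib m s n1 + s * gen_fib m s n2
      end
  end.

Fixpoint gen_lucas (m s : int) (n : nat) : int :=
  match n with
  | 0%N => 2
  | n1.+1 =>
      match n1 with
      | 0%N => m
      | n2.+1 => m * gen_lucas m s n1 + s * gen_lucas m s n2
      end
  end.

(* Main.v *)
Require Import Defs.
From mathcomp Require Import all_boot all_order all_algebra.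
From mathcomp Require Import zify ring.

(** Write D = k^2 + 1.  The element e = k + sqrt D of Z[sqrt D] has norm -1, and
    (V_n + 2 U_n sqrt D) / 2 = e^n for the sequences with parameters (2k, 1):
    this is the content of [lucas_fib_succ], which expresses the passage from
    n to n + 1 as multiplication by e.  Hence x = V_n, y = 2 U_n satisfies
    x^2 - D y^2 = 4 (-1)^n, and odd indices give solutions of norm -4.

    Conversely, let x, y > 0 satisfy x^2 - D y^2 = 4 or -4.  Multiplication by
    1/e = sqrt D - k produces (D y - k x, x - k y), whose norm is the opposite.
    Allowing both signs is what makes the descent one step at a time.  As soon
    as y >= 2 the new pair has a positive first entry and a second entry in
    the range 0 <= x - k y < y, and the value 0 occurs only at
    (x, y) = (2k, 2), that is, at n = 1.  So the descent ends there
    ([pell4_classification]) unless it meets a solution with y = 1.  Such a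
    solution has x^2 = k^2 + 5 or x^2 = k^2 - 3, two squares too close together
    unless k = 2 ([pell4_second_ge2]); this is where k = 2 is exceptional, e
    being then the cube of the unit (1 + sqrt 5) / 2.  Finally the sign of
    the norm determines the parity of n. *)

Set Implicit Arguments.
Unset Strict Implicit.
Unset Printing Implicit Defensive.

Import Order.TTheory GRing.Theory Num.Theory.

Local Open Scope ring_scope.

(** * The Lucas and Fibonacci sequences as powers of k + sqrt (k^2 + 1) *)

Lemma gen_fibSS (m s : int) (n : nat) :
  gen_fib m s n.+2 = m * gen_fib m s n.+1 + s * gen_fib m s n.
Proof. by []. Qed.

Lemma gen_lucasSS (m s : int) (n : nat) :
  gen_lucas m s n.+2 = m * gen_lucas m s n.+1 + s * gen_lucas m s n.
Proof. by []. Qed.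

(** Multiplication by k + sqrt (k^2 + 1) in coordinates.  The two equations need
    each other in the induction. *)
Lemma lucas_fib_succ (k : int) (n : nat) :
  gen_lucas (2 * k) 1 n.+1 =
    k * gen_lucas (2 * k) 1 n + (k ^+ 2 + 1) * (2 * gen_fib (2 * k) 1 n) /\
  2 * gen_fib (2 * k) 1 n.+1 =
    gen_lucas (2 * k) 1 n + k * (2 * gen_fib (2 * k) 1 n).
Proof.
elim: n => [|n [IHV IHU]]; first by split=> /=; ring.
rewrite gen_lucasSS gen_fibSS; split.
  by rewrite IHU IHV; ring.
have -> : 2 * (2 * k * gen_fib (2 * k) 1 n.+1 + 1 * gen_fib (2 * k) 1 n) =
          2 * k * (2 * gen_fib (2 * k) 1 n.+1) + 2 * gen_fib (2 * k) 1 n by ring.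
by rewrite IHU IHV; ring.
Qed.

Lemma lucas_fib_norm (k : int) (n : nat) :
  gen_lucas (2 * k) 1 n ^+ 2 -
    (k ^+ 2 + 1) * (2 * gen_fib (2 * k) 1 n) ^+ 2 = 4 * (-1) ^+ n.
Proof.
elim: n => [|n IH]; first by rewrite /=; ring.
have [-> ->] := lucas_fib_succ k n.
have -> : 4 * (-1) ^+ n.+1 = - (4 * (-1) ^+ n) :> int by rewrite exprS; ring.
by rewrite -IH; ring.
Qed.

Lemma lucas_fib_gt0 (k : int) (n : nat) : 1 <= k ->
  0 < gen_lucas (2 * k) 1 n.+1 /\ 0 < 2 * gen_fib (2 * k) 1 n.+1.
Proof.
move=> k_ge1; elim: n => [|n [IHV IHU]]; first by split=> /=; lia.
have [-> ->] := lucas_fib_succ k n.+1.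
by split; nia.
Qed.

(** * Descent for x^2 - (k^2 + 1) y^2 = 4 or -4 *)

(** If y = 1, then x^2 differs from k^2 by 5 or -3, so x must be k + 1 or k - 1,
    and either one forces k = 2. *)
Lemma pell4_second_ge2 (k x y : int) : 1 <= k -> k <> 2 -> 0 < x -> 0 < y ->
  x ^+ 2 - (k ^+ 2 + 1) * y ^+ 2 = 4 \/
    x ^+ 2 - (k ^+ 2 + 1) * y ^+ 2 = - 4 ->
  2 <= y.
Proof.
move=> k_ge1 k_neq2 x_gt0 y_gt0 norm_xy.
have [//|y_lt2] := leP 2 y.
have y1 : y = 1 by lia.
subst y; case: norm_xy => norm_xy.
- have xk : (x - k) * (x + k) = 5 by lia.
  have : k + 1 <= x by nia.
  rewrite le_eqVlt => /orP[/eqP xE|x_gt]; first by subst x; nia.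
  by nia.
- have xk : (k - x) * (k + x) = 3 by lia.
  have : x <= k - 1 by nia.
  rewrite le_eqVlt => /orP[/eqP xE|x_lt]; first by subst x; nia.
  by nia.
Qed.

(** Division by k + sqrt (k^2 + 1) keeps the first entry positive and decreases
    the second. Each inequality compares squares. *)
Lemma pell4_descent (k x y : int) : 1 <= k -> 0 < x -> 2 <= y ->
  x ^+ 2 - (k ^+ 2 + 1) * y ^+ 2 = 4 \/
    x ^+ 2 - (k ^+ 2 + 1) * y ^+ 2 = - 4 ->
  [/\ 0 < (k ^+ 2 + 1) * y - k * x, 0 <= x - k * y & x - k * y < y].
Proof.
move=> k_ge1 x_gt0 y_ge2 norm_xy.
have y2_ge4 : 4 <= y ^+ 2 by nia.
have k2_ge1 : 1 <= k ^+ 2 by nia.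
have ky2_ge : y ^+ 2 <= k * y ^+ 2 by nia.
split.
- have : (k * x) ^+ 2 < ((k ^+ 2 + 1) * y) ^+ 2.
    rewrite -subr_gt0.
    have -> : ((k ^+ 2 + 1) * y) ^+ 2 - (k * x) ^+ 2 =
        (k ^+ 2 + 1) * y ^+ 2
        - k ^+ 2 * (x ^+ 2 - (k ^+ 2 + 1) * y ^+ 2) by ring.
    by case: norm_xy => ->; nia.
  by rewrite ltr_pXn2r ?nnegrE ?subr_gt0 //; nia.
- have : (k * y) ^+ 2 <= x ^+ 2 by case: norm_xy => ?; lia.
  by rewrite ler_pXn2r ?nnegrE ?subr_ge0 //; nia.
- have : x ^+ 2 < ((k + 1) * y) ^+ 2.
    have -> : ((k + 1) * y) ^+ 2 =
        (k ^+ 2 + 1) * y ^+ 2 + 2 * (k * y ^+ 2) by ring.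
    by case: norm_xy => ?; lia.
  by rewrite ltr_pXn2r ?nnegrE //; [lia | nia | nia].
Qed.

Lemma pell4_classification (k x y : int) : 1 <= k -> k <> 2 -> 0 < x -> 0 < y ->
  x ^+ 2 - (k ^+ 2 + 1) * y ^+ 2 = 4 \/
    x ^+ 2 - (k ^+ 2 + 1) * y ^+ 2 = - 4 ->
  exists n : nat,
    x = gen_lucas (2 * k) 1 n.+1 /\ y = 2 * gen_fib (2 * k) 1 n.+1.
Proof.
move=> k_ge1 k_neq2; have [b] := ubnP `|y|%N.
elim: b x y => // b IH x y y_lt x_gt0 y_gt0 norm_xy.
have y_ge2 := pell4_second_ge2 k_ge1 k_neq2 x_gt0 y_gt0 norm_xy.
have [x'_gt0 y'_ge0 y'_lt] := pell4_descent k_ge1 x_gt0 y_ge2 norm_xy.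
set x' := (k ^+ 2 + 1) * y - k * x in x'_gt0.
set y' := x - k * y in y'_ge0 y'_lt.
have xE : x = k * x' + (k ^+ 2 + 1) * y' by rewrite /x' /y'; ring.
have yE : y = x' + k * y' by rewrite /x' /y'; ring.
have norm_opp : x' ^+ 2 - (k ^+ 2 + 1) * y' ^+ 2 =
    - (x ^+ 2 - (k ^+ 2 + 1) * y ^+ 2) by rewrite /x' /y'; ring.
move: y'_ge0; rewrite le_eqVlt => /orP[/eqP y'0|y'_gt0].
  (* Here x' ^ 2 = 4, so the descent has reached the pair (2, 0) of index 0. *)
  have x'2 : x' = 2 by rewrite -y'0 in norm_opp; nia.
  by exists 0%N; rewrite xE yE -y'0 x'2 /=; split; ring.
have [||n [x'E y'E]] := IH x' y' _ x'_gt0 y'_gt0; first by lia.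
  by rewrite norm_opp; case: norm_xy => ->; [right | left; rewrite opprK].
exists n.+1; have [-> ->] := lucas_fib_succ k n.+1.
by rewrite -x'E -y'E.
Qed.

(** * Positive solutions of x^2 - (k^2 + 1) y^2 = -4 *)

Theorem theorem19 (k : int) (hk1 : 1 <= k) (hk2 : k <> 2) (x y : int) :
  (0 < x /\ 0 < y /\ x ^+ 2 - (k ^+ 2 + 1) * y ^+ 2 = - 4) <->
  (exists n : nat, (1 <= n)%N /\
     (x, y) = (gen_lucas (2 * k) 1 (2 * n - 1)%N,
               2 * gen_fib (2 * k) 1 (2 * n - 1)%N)).
Proof.
split=> [[x_gt0 [y_gt0 norm_xy]]|[n [n_ge1 [-> ->]]]].
  have [n [xE yE]] :=
    pell4_classification hk1 hk2 x_gt0 y_gt0 (or_intror norm_xy).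
  (* The norm 4 (-1)^(n+1) equals -4, so n is even. *)
  have n_even : ~~ odd n.
    move: norm_xy; rewrite xE yE lucas_fib_norm -signr_odd /=.
    by case: (odd n).
  exists (n./2.+1); split=> //.
  have -> : (2 * n./2.+1 - 1)%N = n.+1 by lia.
  by rewrite xE yE.
have idxE : (2 * n - 1)%N = (2 * n.-1).+1 by lia.
rewrite idxE; have [V_gt0 U_gt0] := lucas_fib_gt0 (2 * n.-1) hk1.
split=> //; split=> //.
by rewrite lucas_fib_norm exprS exprM sqrrN !expr1n.
Qed.
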